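(* For each fixed $\rho\in(0,1)$, the absolute welfare difference $u^*_{\mathrm{GA}}(\rho,\nu)-u^*_{\mathrm{RR}}(\rho,\nu)$ tends to $0$ as $\nu\downarrow1$ and as $\nu\to\infty$. Moreover, there is a finite uniform upper bound on the difference: there exists a constant $K<\infty$ such that $$u^*_{\mathrm{GA}}(\rho,\nu)-u^*_{\mathrm{RR}}(\rho,\nu)\le K\qquad\text{for all }\rho\in(0,1)\text{ and all }\nu>0.$$
   Context: A single-server queue has Poisson potential arrivals of rate $\rho\in(0,1)$, exponential service with rate $1$, reward $\nu>0$ per served customer, and holding cost $1$ per customer per unit time in system. Random routing (RR): each arrival is admitted independently with probability $p\in[0,1]$. The stationary welfare per unit time is $u(\pi_p)=\rho p\,\nu-\frac{\rho p}{1-\rho p}$, and $u^*_{\mathrm{RR}}(\rho,\nu)=\max_{p\in[0,1]}u(\pi_p)$. Gated admission (GA): after each admission, arrivals are blocked for $\tau$ time units. For $0\le\tau<\infty$ the stationary welfare per unit time is $$u(\pi_\tau)=\frac{\rho}{1+\rho\tau}\left(\nu-\frac{1}{1-\sigma(\tau)}\right),$$ where $\sigma(\tau)\in(0,1)$ is the smallest positive solution of $\sigma=\frac{\rho e^{-(1-\sigma)\tau}}{\rho+1-\sigma}$. For $\tau=\infty$ (no admissions) $u(\pi_\infty)=0$. Let $u^*_{\mathrm{GA}}(\rho,\nu)=\max_{\tau\in[0,\infty]}u(\pi_\tau)$. *)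

(* Defs.v *)
From HB Require Import structures.
From mathcomp Require Import all_boot all_order all_algebra.
From mathcomp Require Import all_classical all_reals all_analysis.

Set Implicit Arguments.
Unset Strict Implicit.
Unset Printing Implicit Defensive.

Import Order.TTheory GRing.Theory Num.Theory.
Import numFieldNormedType.Exports.

Local Open Scope classical_set_scope.
Local Open Scope ring_scope.

(* [greatest A] and [least A] are attained extrema: unlike [sup] and [inf], they
   take the junk value 0 when the extremum is not an element of A. *)
Definition greatest (R : realType) (A : set R) : R := xget 0 (A `&` ubound A).

Definition least (R : realType) (A : set R) : R := xget 0 (A `&` lbound A).

(* The convention x / 0 = 0 adds no spurious solution here: at s = rho + 1 the
   right-hand side is 0, whereas s > 0. *)
Definition sigma (R : realType) (rho tau : R) : R :=
  least [set s : R |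
    0 < s /\ s = rho * expR (- (1 - s) * tau) / (rho + 1 - s)].

Definition welfareRR (R : realType) (rho nu p : R) : R :=
  rho * p * nu - rho * p / (1 - rho * p).

(* The value at -oo is irrelevant: only tau >= 0 is used. *)
Definition welfareGA (R : realType) (rho nu : R) (tau : \bar R) : R :=
  match tau with
  | EFin t => rho / (1 + rho * t) * (nu - 1 / (1 - sigma rho t))
  | _ => 0
  end.

Definition optRR (R : realType) (rho nu : R) : R :=
  greatest [set welfareRR rho nu p | p in [set p : R | 0 <= p <= 1]].

Definition optGA (R : realType) (rho nu : R) : R :=
  greatest [set welfareGA rho nu tau | tau in [set tau : \bar R | (0 <= tau)%E]].

(* Main.v *)
(** Under gating with parameter [t], the equation for [s = sigma t] reads
    [(rho - s) * (1 - s) = rho * (1 - expR (- (1 - s) * t))], and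
    [1 - expR (- x) <= x] turns it into [rho - s <= rho * t].  Compare gating with
    the random routing [p = 1 / (1 + rho * t)] of the same throughput
    [x = rho * p]: as [1 - s <= 1 - rho + rho * t = (1 - x) * (1 + rho * t)], the
    welfare gain [x / (1 - x) - x / (1 - s)] is at most [x], so [K = 1] works.
    For [nu] near 1 both optima lie between 0 and [nu - 1]; for [nu] large the
    same bound on [s] shows that admitting everybody ([t = 0], [p = 1]) is optimal
    in both families, so the difference vanishes. *)
Require Import Defs.
From HB Require Import structures.
From mathcomp Require Import all_boot all_order all_algebra.
From mathcomp Require Import all_classical all_reals all_analysis.
From mathcomp Require Import ring lra.

Set Implicit Arguments.
Unset Strict Implicit.
Unset Printing Implicit Defensive.

Import Order.TTheory GRing.Theory Num.Theory.
Import numFieldNormedType.Exports.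

Local Open Scope classical_set_scope.
Local Open Scope ring_scope.

(** * Attained extrema *)

Lemma greatest_eq (R : realType) (A : set R) (x : R) :
  A x -> ubound A x -> greatest A = x.
Proof.
move=> Ax ubx; apply: xget_subset1; first by split.
move=> y z [Ay uy] [Az uz]; apply/eqP; rewrite eq_le.
by apply/andP; split; [exact: uz | exact: uy].
Qed.

Lemma least_eq (R : realType) (A : set R) (x : R) :
  A x -> lbound A x -> least A = x.
Proof.
move=> Ax lbx; apply: xget_subset1; first by split.
move=> y z [Ay ly] [Az lz]; apply/eqP; rewrite eq_le.
by apply/andP; split; [exact: ly | exact: lz].
Qed.

(* [0 <= M] covers the junk value, so upper bounds on [optGA] do not require the
   maximum over gates to be attained. *)
Lemma greatest_le (R : realType) (A : set R) (M : R) :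
  0 <= M -> ubound A M -> greatest A <= M.
Proof.
move=> M0 uM; rewrite /greatest; case: xgetP => // x _ [Ax _].
exact: uM.
Qed.

Lemma greatest_ge0 (R : realType) (A : set R) : A 0 -> 0 <= greatest A.
Proof.
by move=> A0; rewrite /greatest; case: xgetP => // x _ [_]; exact.
Qed.

(** * The fixed-point equation for [sigma] *)

Definition sigma_eq (R : realType) (rho t s : R) : Prop :=
  s * (rho + 1 - s) = rho * expR (- (1 - s) * t).

Lemma sigma_eqP (R : realType) (rho t s : R) : 0 < rho -> 0 < s ->
  s = rho * expR (- (1 - s) * t) / (rho + 1 - s) <->
  sigma_eq rho t s.
Proof.
move=> r0 s0; rewrite /sigma_eq; have [d0|d0] := eqVneq (rho + 1 - s) 0.
  (* When the denominator vanishes both sides are false: division by 0 would force [s = 0], and the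
     cleared equation would force an exponential to vanish. *)
  rewrite d0 invr0 !mulr0; split => h; first by rewrite h ltxx in s0.
  by have := mulr_gt0 r0 (expR_gt0 (- (1 - s) * t)); rewrite -h ltxx.
by split => [{1}->|<-]; [rewrite mulfVK | rewrite mulfK].
Qed.

Lemma sigma_eq_sub (R : realType) (rho t s : R) : s < 1 ->
  0 <= rho -> sigma_eq rho t s -> rho - s <= rho * t.
Proof.
rewrite /sigma_eq => s1 r0 hs.
have := expR_ge1Dx (- (1 - s) * t).
move: hs; set e := expR _ => hs he.
rewrite -(ler_pM2r (_ : 0 < 1 - s)); last by rewrite subr_gt0.
have := ler_wpM2l r0 he; rewrite -hs; lra.
Qed.

(** The number 1 is always a root, so two roots [a < b] below 1 would make a strictly concave
    parabola meet a convex exponential at three points. Concretely, the tangent to the exponential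
    at [b] lies below it at [a] and at 1; the two slope estimates together give [1 <= a]. *)
Lemma sigma_eq_inj (R : realType) (rho t a b : R) : 0 < rho ->
  0 < b < 1 -> a < b -> sigma_eq rho t a -> sigma_eq rho t b -> False.
Proof.
rewrite /sigma_eq => r0 /andP[b0 b1] ab ha hb.
set B := b * (rho + 1 - b) in hb.
have B0 : 0 < B by rewrite hb mulr_gt0 ?expR_gt0.
(* The tangent at [b], of slope [t * B], evaluated at [a]. *)
have lo : rho + 1 - a - b <= t * B.
  have he := ler_wpM2l (ltW B0) (expR_ge1Dx (- (b - a) * t)).
  rewrite {2}hb -(mulrA rho) -expRD in he.
  have e : - (1 - b) * t + - (b - a) * t = - (1 - a) * t by ring.
  rewrite e -ha in he.
  rewrite -(ler_pM2l (_ : 0 < b - a)) ?subr_gt0 //.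
  by move: he; rewrite /B; lra.
(* The same tangent evaluated at the root 1. *)
have hi : t * B <= rho - b.
  have he := ler_wpM2l (ltW B0) (expR_ge1Dx ((1 - b) * t)).
  rewrite {2}hb -(mulrA rho) -expRD in he.
  have e : - (1 - b) * t + (1 - b) * t = 0 by ring.
  rewrite e expR0 in he.
  rewrite -(ler_pM2l (_ : 0 < 1 - b)) ?subr_gt0 //.
  by move: he; rewrite /B; lra.
lra.
Qed.

(** Intermediate values on [[0, rho]]; stopping at [rho < 1] keeps the root away from the trivial
    root 1. *)
Lemma sigma_eq_ex (R : realType) (rho t : R) : 0 < rho < 1 -> 0 <= t ->
  exists s, 0 < s <= rho /\ sigma_eq rho t s.
Proof.
move=> /andP[r0 r1] t0.
pose F (s : R) := s * (rho + 1 - s) - rho * expR (- (1 - s) * t).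
have cF : {within `[0, rho], continuous F}.
  apply: continuous_subspaceT => x.
  rewrite /F; apply: cvgB; first by apply: cvgM; [|apply: cvgB; [exact: cvg_cst|]].
  apply: cvgM; first exact: cvg_cst.
  apply: (@continuous_comp _ _ _ (fun s : R => - (1 - s) * t) expR); last exact: continuous_expR.
  apply: cvgM; last exact: cvg_cst.
  by apply: cvgN; apply: cvgB; first exact: cvg_cst.
have F0 : F 0 < 0.
  by rewrite /F mul0r sub0r oppr_lt0 mulr_gt0 ?expR_gt0.
have Fr : 0 <= F rho.
  have : expR (- (1 - rho) * t) <= 1.
    by rewrite expR_le1 mulNr oppr_le0 mulr_ge0 // subr_ge0 ltW.
  by move/(ler_wpM2l (ltW r0)); rewrite /F; lra.
have [|c] := @IVT _ F 0 rho 0 (ltW r0) cF.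
  by rewrite ge_min le_max (ltW F0) Fr orbT.
rewrite in_itv /= => /andP[c0 cr] Fc; exists c; split.
  rewrite cr andbT lt_neqAle c0 andbT; apply/eqP => c0'.
  by move: F0; rewrite {1}c0' Fc ltxx.
by apply/eqP; rewrite /sigma_eq -subr_eq0 -/(F c) Fc.
Qed.

Lemma sigma_unique (R : realType) (rho t s : R) : 0 < rho -> 0 < s < 1 ->
  sigma_eq rho t s -> sigma rho t = s.
Proof.
move=> r0 /andP[s0 s1] hs; apply: least_eq.
  by split=> //; apply/sigma_eqP.
move=> y [y0 /(sigma_eqP _ r0 y0) hy].
rewrite leNgt; apply/negP => ys.
by apply: (sigma_eq_inj r0 _ ys hy hs); rewrite s0 s1.
Qed.

Lemma sigma_bounds (R : realType) (rho t : R) : 0 < rho < 1 -> 0 <= t ->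
  0 < sigma rho t <= rho /\ rho - sigma rho t <= rho * t.
Proof.
move=> hr t0; have [s [hs es]] := sigma_eq_ex hr t0.
have /andP[r0 r1] := hr; have /andP[s0 sr] := hs.
have s1 : s < 1 by exact: le_lt_trans r1.
rewrite (sigma_unique (s := s) r0) ?s0 //; split=> //.
exact: sigma_eq_sub (ltW r0) es.
Qed.

(** * Bounds on welfare and its optima *)

Lemma sigma0 (R : realType) (rho : R) : 0 < rho < 1 -> sigma rho 0 = rho.
Proof.
move=> /andP[r0 r1]; apply: sigma_unique; rewrite ?r0 //.
by rewrite /sigma_eq mulr0 expR0; ring.
Qed.

Lemma welfareGA0 (R : realType) (rho nu : R) : 0 < rho < 1 ->
  welfareGA rho nu 0%E = welfareRR rho nu 1.
Proof.
by move=> hr; rewrite /welfareGA /welfareRR /= sigma0 // !mulr0 addr0; field; lra.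
Qed.

(** By compactness the maximum is attained, so [optRR] is the true maximum and not the default 0. *)
Lemma optRR_ge (R : realType) (rho nu p : R) : 0 < rho < 1 -> 0 <= p <= 1 ->
  welfareRR rho nu p <= optRR rho nu.
Proof.
move=> /andP[r0 r1] hp.
have d0 (x : R) : 0 <= x <= 1 -> 1 - rho * x != 0 by move=> ?; nra.
have cW : {within `[0, 1], continuous (welfareRR rho nu)}.
  apply: continuous_in_subspaceT => x; rewrite inE /= in_itv /= => x01.
  have cl : (fun y : R => rho * y) @ x --> rho * x.
    by apply: cvgM; [exact: cvg_cst | exact: cvg_id].
  rewrite /welfareRR; apply: cvgB; apply: cvgM => //; first exact: cvg_cst.
  apply: cvgV; first exact: d0.
  by apply: cvgB => //; exact: cvg_cst.
have [c c01 hc] := EVT_max ler01 cW.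
rewrite /optRR (greatest_eq (x := welfareRR rho nu c)).
- by apply: hc; rewrite in_itv.
- by exists c; rewrite //= -in_itv.
- by move=> _ [q /= q01 <-]; apply: hc; rewrite in_itv.
Qed.

Lemma optRR_ge0 (R : realType) (rho nu : R) : 0 <= optRR rho nu.
Proof.
apply: greatest_ge0; exists 0; first by rewrite /= lexx ler01.
by rewrite /welfareRR !mulr0 !mul0r subr0.
Qed.

Lemma optGA_ge0 (R : realType) (rho nu : R) : 0 <= optGA rho nu.
Proof. by apply: greatest_ge0; exists +oo%E => //=; exact: leey. Qed.

Lemma optGA_le (R : realType) (rho nu M : R) : 0 <= M ->
  (forall t : R, 0 <= t -> welfareGA rho nu t%:E <= M) -> optGA rho nu <= M.
Proof.
move=> M0 hM; apply: greatest_le => // _ [[t| |] /= t0 <-] //.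
by apply: hM; rewrite -lee_fin.
Qed.

Lemma welfareGA_le_RR (R : realType) (rho nu t : R) : 0 < rho < 1 -> 0 <= t ->
  welfareGA rho nu t%:E <= welfareRR rho nu (1 + rho * t)^-1 + 1.
Proof.
move=> hr t0; have /andP[r0 r1] := hr.
have [/andP[s0 sr] st] := sigma_bounds hr t0.
rewrite /welfareGA /welfareRR; set s := sigma rho t in s0 sr st *.
have a0 : 0 <= rho * t by rewrite mulr_ge0 // ltW.
set a := rho * t in st a0 *.
have inv : (1 - rho + a)^-1 <= (1 - s)^-1.
  by rewrite lef_pV2 ?posrE; lra.
have eqW : rho / (1 + a) * nu - rho / (1 + a) / (1 - rho / (1 + a)) =
           rho / (1 + a) * nu - rho / (1 - rho + a).
  by field; apply/andP; split; lra.
rewrite eqW div1r mulrBr -addrA lerD2l.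
have x0 : 0 <= rho / (1 + a) by rewrite divr_ge0; lra.
have := ler_wpM2l x0 inv; rewrite -lerN2 => /le_trans; apply.
(* The excess over random routing is [rho] times a second factor, each at most 1. *)
have -> : - (rho / (1 + a) * (1 - rho + a)^-1) =
  - (rho / (1 - rho + a)) + rho * (a / (1 - rho + a) / (1 + a)).
  by field; apply/andP; split; lra.
rewrite lerD2l -(mul1r 1) ler_pM ?(ltW r0) ?(ltW r1) //.
  by rewrite !divr_ge0 //; lra.
rewrite ler_pdivrMr; last lra.
by rewrite mul1r ler_pdivrMr; [nra | lra].
Qed.

Lemma optGA_near1 (R : realType) (rho nu : R) : 0 < rho < 1 -> 1 <= nu ->
  optGA rho nu <= nu - 1.
Proof.
move=> hr n1; apply: optGA_le; first by rewrite subr_ge0.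
move=> t t0; have /andP[r0 r1] := hr.
have [/andP[s0 sr] _] := sigma_bounds hr t0.
have a0 : 0 <= rho * t by rewrite mulr_ge0 // ltW.
rewrite /welfareGA -[leRHS]mul1r.
have x0 : 0 <= rho / (1 + rho * t) by rewrite divr_ge0; lra.
have x1 : rho / (1 + rho * t) <= 1 by rewrite ler_pdivrMr; lra.
have y1 : 1 <= 1 / (1 - sigma rho t) by rewrite ler_pdivlMr; lra.
apply: (@le_trans _ _ (rho / (1 + rho * t) * (nu - 1))).
  by apply: ler_wpM2l => //; lra.
by apply: ler_wpM2r => //; lra.
Qed.

Lemma optRR_near1 (R : realType) (rho nu : R) : 0 < rho < 1 -> 1 <= nu ->
  optRR rho nu <= nu - 1.
Proof.
move=> /andP[r0 r1] n1; apply: greatest_le; first by rewrite subr_ge0.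
move=> _ [p /= /andP[p0 p1] <-]; rewrite /welfareRR.
have x0 : 0 <= rho * p by rewrite mulr_ge0 // ltW.
have x1 : rho * p < 1 by nra.
have : rho * p <= rho * p / (1 - rho * p) by rewrite ler_pdivlMr; nra.
nra.
Qed.

(** * Large rewards *)

Section LargeReward.
Context {R : realType} (rho nu : R).
(** Random routing needs [nu * (1 - rho) ^+ 2 >= 1] and the gating estimate needs [2 - rho] in place
    of 1; the constant 2 covers both. *)
Hypotheses (hr : 0 < rho < 1) (hnu : 2 / (1 - rho) ^+ 2 <= nu).

Let hnu' : 2 <= nu * (1 - rho) ^+ 2.
Proof. by move: hnu; rewrite ler_pdivrMr // exprn_gt0 // subr_gt0; case/andP: hr. Qed.

Lemma welfareRR_le1 (p : R) : 0 <= p <= 1 ->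
  welfareRR rho nu p <= welfareRR rho nu 1.
Proof.
move=> /andP[p0 p1]; have /andP[r0 r1] := hr; rewrite /welfareRR mulr1.
have x1 : rho * p <= rho by nra.
set x := rho * p in x1 *.
rewrite -subr_ge0.
have -> : rho * nu - rho / (1 - rho) - (x * nu - x / (1 - x)) =
  (rho - x) * ((nu * ((1 - rho) * (1 - x)) - 1) / ((1 - rho) * (1 - x))).
  by field; apply/andP; split; lra.
have n0 : 0 <= nu by rewrite (le_trans _ hnu) // divr_ge0 // exprn_ge0; lra.
have h : nu * (1 - rho) ^+ 2 <= nu * ((1 - rho) * (1 - x)).
  by rewrite ler_wpM2l // expr2 ler_pM2l; lra.
apply: mulr_ge0; first by rewrite subr_ge0.
apply: divr_ge0; last by rewrite mulr_ge0; lra.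
by move: hnu'; rewrite expr2; lra.
Qed.

Lemma welfareGA_le0 (t : R) : 0 <= t ->
  welfareGA rho nu t%:E <= welfareRR rho nu 1.
Proof.
move=> t0; have /andP[r0 r1] := hr.
have [/andP[s0 sr] st] := sigma_bounds hr t0.
rewrite /welfareGA /welfareRR mulr1; set s := sigma rho t in s0 sr st *.
have a0 : 0 <= rho * t by rewrite mulr_ge0 // ltW.
set a := rho * t in st a0 *.
have -> : rho / (1 + a) * (nu - 1 / (1 - s)) =
          rho * (nu - 1 / (1 - s)) / (1 + a) by field; apply/andP; split; lra.
have -> : rho * nu - rho / (1 - rho) = rho * (nu - 1 / (1 - rho)).
  by field; lra.
rewrite ler_pdivrMr; last lra.
rewrite -mulrA ler_pM2l //.
rewrite -subr_ge0.
(* The term in [a] is the net reward lost by blocking; the other is the sojourn time saved, at most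
   of order [a] because [rho - s <= a]. *)
have -> : (nu - 1 / (1 - rho)) * (1 + a) - (nu - 1 / (1 - s)) =
  (a * (nu * (1 - rho) - 1) - (rho - s) / (1 - s)) / (1 - rho).
  by field; apply/andP; split; lra.
apply: divr_ge0; last lra.
have h1 : (rho - s) / (1 - s) <= a / (1 - rho).
  by apply: ler_pM; rewrite ?invr_ge0 ?lef_pV2 ?posrE //; lra.
have h2 : a * (1 - rho)^-1 <= a * (nu * (1 - rho) - 1).
  apply: ler_wpM2l => //.
  rewrite -(ler_pM2r (_ : 0 < 1 - rho)) ?subr_gt0 // mulVf; last lra.
  by move: hnu'; rewrite expr2; nra.
lra.
Qed.

Lemma optGA_eq_optRR : optGA rho nu = optRR rho nu.
Proof.
(* This handles the gate [+oo], whose welfare is 0. *)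
have W0 : 0 <= welfareRR rho nu 1.
  have -> : 0 = welfareRR rho nu 0 by rewrite /welfareRR !mulr0 !mul0r subr0.
  by apply: welfareRR_le1; rewrite lexx ler01.
transitivity (welfareRR rho nu 1); last apply/esym; apply: greatest_eq.
- by exists 0%E; [exact: lexx | exact: welfareGA0].
- by move=> _ [[t| |] /= t0 <-] //; apply: welfareGA_le0; rewrite -lee_fin.
- by exists 1; rewrite //= ler01 lexx.
- by move=> _ [p /= p01 <-]; exact: welfareRR_le1.
Qed.

End LargeReward.

Theorem mainTheorem6 (R : realType) :
  (forall rho : R, 0 < rho < 1 ->
     ((optGA rho nu - optRR rho nu) @[nu --> (1 : R)^'+] --> (0 : R)) /\
     ((optGA rho nu - optRR rho nu) @[nu --> +oo] --> (0 : R))) /\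
  (exists K : R, forall rho nu : R, 0 < rho < 1 -> 0 < nu ->
     optGA rho nu - optRR rho nu <= K).
Proof.
split.
  move=> rho hr; split.
    have lim : (nu - 1) @[nu --> (1 : R)^'+] --> (0 : R).
      apply: cvg_at_right_filter; rewrite -(subrr (1 : R)).
      by apply: cvgB; [exact: cvg_id | exact: cvg_cst].
    apply: (@squeeze_cvgr _ _ _ _ (fun nu : R => - (nu - 1)) (fun nu => nu - 1)) => //.
      near=> nu.
      have n1 : 1 <= nu by near: nu; exact: nbhs_right_ge.
      have := optGA_near1 hr n1; have := optRR_near1 hr n1.
      by have := optRR_ge0 rho nu; have := optGA_ge0 rho nu; lra.
    by rewrite -oppr0; exact: cvgN lim.
  apply: (@cvg_trans _ (cst (0 : R) @ +oo)); last exact: cvg_cst.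
  apply: near_eq_cvg; near=> nu.
  have hnu : 2 / (1 - rho) ^+ 2 <= nu.
    by near: nu; apply: nbhs_pinfty_ge; exact: num_real.
  by rewrite /= (optGA_eq_optRR hr hnu) subrr.
exists 1 => rho nu hr nu0; rewrite lerBlDl.
apply: optGA_le; first by rewrite addr_ge0 // optRR_ge0.
move=> t t0; apply: (le_trans (welfareGA_le_RR nu hr t0)).
rewrite lerD2r; apply: optRR_ge => //.
have /andP[r0 _] := hr.
have a0 : 0 <= rho * t by rewrite mulr_ge0 // ltW.
by rewrite invr_ge0 invf_le1; lra.
Unshelve. all: by end_near.
Qed.
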